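(* Consider the elliptic variational inequality setting described in the context, with exact solution $(u,(p,\lambda,\omega))\in K\times T$, generalized constitutive relation error $\Psi$, and error functionals $\bar\phi_{(u,(p,\lambda,\omega))}$, $\bar\phi^*_{(u,(p,\lambda,\omega))}$. Then for all admissible solutions $(\hat u,(\hat p,\hat\lambda,\hat\omega))\in K\times T$, $$\Psi(\hat u,(\hat p,\hat\lambda,\hat\omega))=\bar\phi_{(u,(p,\lambda,\omega))}(\hat u-u)+\bar\phi^*_{(u,(p,\lambda,\omega))}(\hat p-p,\hat\lambda-\lambda,\hat\omega-\omega),$$ and $\Psi$ provides an upper bound for the global energy error of either of the admissible solutions $\hat u$, $\hat p$: $$\Psi(\hat u,(\hat p,\hat\lambda,\hat\omega))\ \ge\ \bar\phi_{(u,(p,\lambda,\omega))}(\hat u-u)\ \ge\ \tfrac12 a(u-\hat u,u-\hat u),$$ $$\Psi(\hat u,(\hat p,\hat\lambda,\hat\omega))\ \ge\ \bar\phi^*_{(u,(p,\lambda,\omega))}(\hat p-p,\hat\lambda-\lambda,\hat\omega-\omega)\ \ge\ \tfrac12[p-\hat p,p-\hat p].$$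
   Context: Setting. $V,S,L,Q$ are real Hilbert spaces with zero elements $\theta_V,\theta_S,\theta_L,\theta_Q$; $[\cdot,\cdot]$ is the inner product of $S$; $\mathcal{A}:V\to S$ is a linear (differential) operator, and the bilinear form $a(u,v)=[\mathcal{A}u,\mathcal{A}v]$ on $V\times V$ is assumed continuous and coercive. $l\in V'$, $g_1\in L'$, $g_2\in Q'$ are continuous linear forms; $b_1:V\times L\to\mathbb{R}$ and $b_2:V\times Q\to\mathbb{R}$ are continuous bilinear forms. $M\subset L$ is a convex cone with vertex at $\theta_L$, and $N\subset Q$ is a bounded subset. The set $$K=\{v\in V:\ b_1(v,\eta)\ge g_1(\eta)\ \ \forall\eta\in M\}$$ is closed, convex and nonempty, and the functional $$j(v)=\max_{\xi\in N}\{-b_2(v,\xi)+g_2(\xi)\},\quad v\in V$$ (the maximum being assumed to exist), is convex and lower semi-continuous. It is assumed that, for $(\eta,\xi)\in L\times Q$, one has $b_1(v,\eta)+b_2(v,\xi)=0$ for all $v\in V$ if and only if $(\eta,\xi)=(\theta_L,\theta_Q)$. Set $$T=\{(q,\eta,\xi)\in S\times M\times N:\ [q,\mathcal{A}v]=b_1(v,\eta)+b_2(v,\xi)+l(v)\ \ \forall v\in V\}.$$ Exact solution. The problem is to find $u\in K$ and $(p,\lambda,\omega)\in T$ with $$p=\mathcal{A}u,\qquad b_1(u,\lambda)-g_1(\lambda)=0,\qquad b_2(u,\omega)-g_2(\omega)+j(u)=0;$$ it is assumed to have a (unique) solution $(u,(p,\lambda,\omega))$, called the exact solution; $u$ is the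 minimizer over $K$ of $\frac12a(v,v)-l(v)+j(v)$. GCRE and error functionals. Put $$\phi(v)=\tfrac12a(v,v)+j(v)\ (v\in V),\qquad \phi^*(q,\eta,\xi)=\tfrac12[q,q]-g_1(\eta)-g_2(\xi)\ ((q,\eta,\xi)\in S\times L\times Q),$$ $$\mathcal{B}(v,(q,\eta,\xi))=[q,\mathcal{A}v]-b_1(v,\eta)-b_2(v,\xi).$$ The generalized constitutive relation error (GCRE) is, for $(\hat u,(\hat p,\hat\lambda,\hat\omega))\in K\times T$, $$\Psi(\hat u,(\hat p,\hat\lambda,\hat\omega))=\tfrac12[\hat p-\mathcal{A}\hat u,\hat p-\mathcal{A}\hat u]+b_1(\hat u,\hat\lambda)-g_1(\hat\lambda)+b_2(\hat u,\hat\omega)-g_2(\hat\omega)+j(\hat u)$$ $$=\phi(\hat u)+\phi^*(\hat p,\hat\lambda,\hat\omega)-\mathcal{B}(\hat u,(\hat p,\hat\lambda,\hat\omega)).$$ The error functionals are $$\bar\phi_{(u,(p,\lambda,\omega))}(e)=\phi(u+e)-\phi(u)-\mathcal{B}(e,(p,\lambda,\omega)),\quad e\in V,$$ $$\bar\phi^*_{(u,(p,\lambda,\omega))}(r)=\phi^*((p,\lambda,\omega)+r)-\phi^*(p,\lambda,\omega)-\mathcal{B}(u,r),\quad r\in S\times L\times Q.$$ *)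

(* Defs.v *)
From HB Require Import structures.
From mathcomp Require Import all_boot all_order all_algebra.
From mathcomp Require Import boolp classical_sets reals ereal topology.
From mathcomp Require Import normedtype convex.
Set Implicit Arguments.
Unset Strict Implicit.
Unset Printing Implicit Defensive.
Import Order.TTheory GRing.Theory Num.Theory.
Import numFieldNormedType.Exports.
Local Open Scope classical_set_scope.
Local Open Scope ring_scope.

(* A real Hilbert space is a complete normed module whose norm is induced by
   an inner product, i.e. a symmetric positive definite bilinear form. *)
HB.mixin Record CompleteNormedModule_isHilbert (R : realType) V
    & CompleteNormedModule R V := {
  inner : {dot V for @idfun R} ;
  inner_normE : forall v : V, inner v v = `|v| ^+ 2
}.

#[short(type="hilbertType")]
HB.structure Definition Hilbert (R : realType) :=
  {V of CompleteNormedModule R V & CompleteNormedModule_isHilbert R V}.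

Notation "''[' u , v ]" := (inner u v) : ring_scope.

Definition continuous_form (R : realType) (V : normedModType R)
  (f : {scalar V}) := continuous (f : V -> R).

(* Joint continuity on the product space. *)
Definition continuous_biform (R : realType) (V W : normedModType R)
  (b : V -> W -> R) := continuous (fun z : V * W => b z.1 z.2).

Definition coercive (R : realType) (V : normedModType R) (b : V -> V -> R) :=
  exists2 alpha : R, 0 < alpha & forall v, alpha * `|v| ^+ 2 <= b v v.

(* The vertex itself need not belong to the cone. *)
Definition cone_at (R : realType) (L : lmodType R) (x0 : L) (C : set L) :=
  forall (x : L) (t : R), 0 < t -> C x -> C (x0 + t *: (x - x0)).

Definition is_max (R : realType) (E : set R) (m : R) := E m /\ ubound E m.

Record vi_data (R : realType) (V S L Q : hilbertType R) := ViData {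
  opA : {linear V -> S} ;
  l_ : {scalar V} ;
  g1 : {scalar L} ;
  g2 : {scalar Q} ;
  b1 : {bilinear V -> L -> R | *%R & *%R} ;
  b2 : {bilinear V -> Q -> R | *%R & *%R} ;
  coneM : set L ;
  bddN : set Q
}.

Section VariationalInequality.
Variables (R : realType) (V S L Q : hilbertType R) (D : vi_data V S L Q).

Local Notation A := (opA D).
Local Notation l := (l_ D).
Local Notation g1 := (g1 D).
Local Notation g2 := (g2 D).
Local Notation b1 := (b1 D).
Local Notation b2 := (b2 D).
Local Notation M := (coneM D).
Local Notation N := (bddN D).

Definition energy (u v : V) : R := '[A u, A v].

Definition setK : set V := [set v | forall eta, M eta -> g1 eta <= b1 v eta].

Definition j_values (v : V) : set R := [set - b2 v xi + g2 xi | xi in N].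

(* The supremum is a maximum under [vi_assumptions]. *)
Definition jfun (v : V) : R := sup (j_values v).

Definition setT_adm : set (S * L * Q) :=
  [set s | let: (q, eta, xi) := s in
    [/\ M eta, N xi & forall v, '[q, A v] = b1 v eta + b2 v xi + l v]].

Record vi_assumptions : Prop := ViAssumptions {
  energy_continuous : continuous_biform energy ;
  energy_coercive : coercive energy ;
  l_continuous : continuous_form l ;
  g1_continuous : continuous_form g1 ;
  g2_continuous : continuous_form g2 ;
  b1_continuous : continuous_biform b1 ;
  b2_continuous : continuous_biform b2 ;
  M_convex : convex_set (M : set (convex_lmodType L)) ;
  M_cone : cone_at 0 M ;
  N_bounded : bounded_set N ;
  K_closed : closed setK ;
  K_convex : convex_set (setK : set (convex_lmodType V)) ;
  K_nonempty : setK !=set0 ;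
  j_max : forall v, exists m, is_max (j_values v) m ;
  j_convex : convex_function [set: convex_lmodType V] jfun ;
  j_lsc : lower_semicontinuous (fun v => (jfun v)%:E) ;
  b_injective : forall (eta : L) (xi : Q),
    (forall v, b1 v eta + b2 v xi = 0) <-> (eta, xi) = (0, 0)
}.

Definition vi_solution (x : V * (S * L * Q)) : Prop :=
  let: (u, (p, lambda, omega)) := x in
  setK u /\ setT_adm (p, lambda, omega) /\
  [/\ p = A u,
      b1 u lambda - g1 lambda = 0
    & b2 u omega - g2 omega + jfun u = 0].

Definition exact_solution (u : V) (s : S * L * Q) : Prop :=
  unique vi_solution (u, s).

Definition primal_phi (v : V) : R := 2^-1 * energy v v + jfun v.

Definition dual_phi (s : S * L * Q) : R :=
  let: (q, eta, xi) := s in 2^-1 * '[q, q] - g1 eta - g2 xi.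

Definition mixedB (v : V) (s : S * L * Q) : R :=
  let: (q, eta, xi) := s in '[q, A v] - b1 v eta - b2 v xi.

(* The generalized constitutive relation error. *)
Definition gcre (v : V) (s : S * L * Q) : R :=
  let: (q, eta, xi) := s in
  2^-1 * '[q - A v, q - A v] + b1 v eta - g1 eta + b2 v xi - g2 xi + jfun v.

Definition err_phi (u : V) (s : S * L * Q) (e : V) : R :=
  primal_phi (u + e) - primal_phi u - mixedB e s.

Definition err_phi_star (u : V) (s r : S * L * Q) : R :=
  dual_phi (s + r) - dual_phi s - mixedB u r.

End VariationalInequality.

(* Main.v *)
(** Since [p = A u], expanding the squares leaves in each error functional half
    the square of the corresponding error plus the residuals
    [b1 v eta - g1 eta] and [b2 v xi - g2 xi + j v], which are nonnegative for
    admissible [v], [eta], [xi] and vanish at the exact solution. The cross term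
    [['[ph - p, A (uh - u)]]] in [Psi] is evaluated by subtracting the two
    equilibrium equations. *)
Require Import Defs.
From HB Require Import structures.
From mathcomp Require Import all_boot all_order all_algebra.
From mathcomp Require Import boolp classical_sets reals ereal topology.
From mathcomp Require Import normedtype convex.
From mathcomp Require Import ring lra.
Import Order.TTheory GRing.Theory Num.Theory.
Import numFieldNormedType.Exports.
Local Open Scope classical_set_scope.
Local Open Scope ring_scope.

Section InnerProduct.
Context {R : realType} {S : hilbertType R}.
Implicit Types x y : S.

Lemma inner_sym x y : '[x, y] = '[y, x].
Proof. by rewrite hermC /= expr0 mul1r. Qed.

Lemma inner_ge0 x : 0 <= '[x, x].
Proof. by rewrite inner_normE sqr_ge0. Qed.

Lemma inner_sqrB x y : '[x - y, x - y] = '[x, x] - 2 * '[x, y] + '[y, y].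
Proof. by rewrite !linearBl !linearBr /= (inner_sym y x); ring. Qed.

End InnerProduct.

(** The maximum bounds the values from above; without such a bound [sup] would be a default
    value. *)
Lemma jfun_ge {R : realType} {V S L Q : hilbertType R} {D : vi_data V S L Q}
    {v : V} {xi : Q} :
  (exists m, is_max (j_values D v) m) -> bddN D xi ->
  - b2 D v xi + g2 D xi <= jfun D v.
Proof.
move=> [m [_ ub_m]] Nxi; apply: ub_le_sup; first by exists m.
by exists xi.
Qed.

Theorem theorem4p4 (R : realType) (V S L Q : hilbertType R)
    (D : vi_data V S L Q) (HD : vi_assumptions D)
    (u : V) (p : S) (lambda : L) (omega : Q)
    (Hex : exact_solution D u (p, lambda, omega))
    (uh : V) (ph : S) (lambdah : L) (omegah : Q)
    (HK : setK D uh) (HT : setT_adm D (ph, lambdah, omegah)) :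
  let Psi := gcre D uh (ph, lambdah, omegah) in
  let ephi := err_phi D u (p, lambda, omega) (uh - u) in
  let ephi_star := err_phi_star D u (p, lambda, omega)
                     (ph - p, lambdah - lambda, omegah - omega) in
  [/\ Psi = ephi + ephi_star,
      Psi >= ephi,
      ephi >= 2^-1 * energy D (u - uh) (u - uh),
      Psi >= ephi_star
    & ephi_star >= 2^-1 * '[p - ph, p - ph]].
Proof.
move=> Psi ephi ephi_star.
case: Hex => -[Ku [[Mlambda Nomega eq_p] [def_p res1 res2]]] _.
case: HT => Mlambdah Nomegah eq_ph.
(* The residuals pair crosswise: [uh] with the exact multipliers, [u] with the admissible ones. *)
have jh := jfun_ge (j_max HD uh) Nomega.
have ju := jfun_ge (j_max HD u) Nomegah.
have b1h := HK _ Mlambda.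
have b1u := Ku _ Mlambdah.
have ephiE : ephi = 2^-1 * energy D (u - uh) (u - uh)
    + (b1 D uh lambda - g1 D lambda)
    + (b2 D uh omega - g2 D omega + jfun D uh).
  rewrite /ephi /err_phi /primal_phi /mixedB /energy subrKC def_p.
  rewrite !linearBl !(linearB (opA D)) inner_sqrB !linearBr /=.
  (* [res1] and [res2] eliminate the terms in [b1 D u lambda], [b2 D u omega] and [jfun D u]. *)
  lra.
have ephi_starE : ephi_star = 2^-1 * '[p - ph, p - ph]
    + (b1 D u lambdah - g1 D lambdah)
    + (b2 D u omegah - g2 D omegah + jfun D u).
  rewrite /ephi_star /err_phi_star /dual_phi /mixedB /= !subrKC -def_p.
  rewrite inner_sqrB !linearBl !linearBr /= (inner_sym ph p).
  lra.
have PsiE : Psi = ephi + ephi_star.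
  rewrite ephiE ephi_starE /Psi /gcre /energy (linearB (opA D)) !inner_sqrB.
  (* Differencing over both the fields and the test vectors cancels [l]; what remains is linear in
     the values of the forms. *)
  have := eq_p uh; have := eq_p u; have := eq_ph uh; have := eq_ph u.
  rewrite -def_p (inner_sym ph p).
  lra.
have energy_ge0 := inner_ge0 (opA D (u - uh)).
have dual_ge0 := inner_ge0 (p - ph).
rewrite PsiE; move: ephiE ephi_starE; rewrite /energy => ephiE ephi_starE.
by split; lra.
Qed.
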